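(* Let $G$ be a connected bipartite graph with $|V(G)|=|E(G)|$, and let $G'=K_1\vee G$ with universal vertex $v_1$. Then $G'$ is $f$-DP-colorable, where $f(v_1)=2$ and $f(v)=3$ for all $v\in V(G')\setminus\{v_1\}$.
   Context: All graphs are finite and simple. $K_1\vee G$ (the cone of $G$) is obtained by adding one new vertex (the universal vertex) adjacent to all vertices of $G$. A cover of a graph $G$ is a pair $\mathcal{H}=(L,H)$ where $H$ is a graph and $L:V(G)\to\mathcal{P}(V(H))$ satisfies: (1) $\{L(u):u\in V(G)\}$ is a partition of $V(H)$; (2) each $H[L(u)]$ is complete; (3) if $E_H(L(u),L(v))\neq\emptyset$ then $u=v$ or $uv\in E(G)$; (4) if $uv\in E(G)$ then $E_H(L(u),L(v))$ is a matching (possibly empty). An $\mathcal{H}$-coloring of $G$ is an independent set in $H$ of size $|V(G)|$. For $f:V(G)\to\mathbb{N}$, $\mathcal{H}$ is an $f$-cover if $|L(u)|=f(u)$ for all $u$, and $G$ is $f$-DP-colorable if $G$ has an $\mathcal{H}$-coloring for every $f$-cover $\mathcal{H}$ of $G$. *)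

(* Defs.v *)
From mathcomp Require Import all_boot.

Set Implicit Arguments.
Unset Strict Implicit.
Unset Printing Implicit Defensive.

Record sgraph := SGraph {
  vertex :> finType;
  adj : rel vertex;
  adj_sym : symmetric adj;
  adj_irrefl : irreflexive adj
}.

(* Edges are unordered pairs, encoded as two-element sets of vertices. *)
Definition edges_between (G : sgraph) (A B : {set G}) : {set {set G}} :=
  [set [set x; y] | x in A, y in B & adj x y].

Definition edges (G : sgraph) : {set {set G}} :=
  edges_between [set: G] [set: G].

(* A set of edges is a matching when distinct edges share no vertex. *)
Definition matching (G : sgraph) (M : {set {set G}}) : Prop :=
  M \subset edges G /\ trivIset M.

Definition complete_on (G : sgraph) (A : {set G}) : Prop :=
  {in A &, forall x y, x != y -> adj x y}.

Definition independent (G : sgraph) (A : {set G}) : Prop :=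
  {in A &, forall x y, ~~ adj x y}.

Definition connected (G : sgraph) : Prop :=
  0 < #|G| /\ forall x y : G, connect (@adj G) x y.

Definition bipartite (G : sgraph) : Prop :=
  exists A : {set G}, forall x y : G, adj x y -> (x \in A) != (y \in A).

Section Cone.
Variable G : sgraph.

Definition cone_adj (x y : option G) : bool :=
  match x, y with
  | None, None => false
  | Some u, Some v => adj u v
  | _, _ => true
  end.

Lemma cone_adj_sym : symmetric cone_adj.
Proof. by case=> [u|] [v|] //=; apply: adj_sym. Qed.

Lemma cone_adj_irrefl : irreflexive cone_adj.
Proof. by case=> [u|] //=; apply: adj_irrefl. Qed.

Definition cone : sgraph := SGraph cone_adj_sym cone_adj_irrefl.

Definition apex : cone := None.

End Cone.

(* The partition condition is stated for the indexed family (L u): lists of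
   distinct vertices are disjoint, and an empty list is allowed (f u = 0). *)
Record is_cover (G H : sgraph) (L : G -> {set H}) : Prop := IsCover {
  cover_disjoint : forall u v : G, u != v -> [disjoint L u & L v];
  cover_full : \bigcup_(u : G) L u = [set: H];
  cover_complete : forall u : G, complete_on (L u);
  cover_edges : forall u v : G,
    edges_between (L u) (L v) != set0 -> u = v \/ adj u v;
  cover_matching : forall u v : G,
    adj u v -> matching (edges_between (L u) (L v))
}.

(* An H-coloring of G; L plays no role in the definition itself. *)
Definition is_coloring (G H : sgraph) (I : {set H}) : Prop :=
  independent I /\ #|I| = #|G|.

Definition is_fcover (G H : sgraph) (L : G -> {set H}) (f : G -> nat) : Prop :=
  is_cover L /\ forall u : G, #|L u| = f u.

Definition DP_colorable (G : sgraph) (f : G -> nat) : Prop :=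
  forall (H : sgraph) (L : G -> {set H}),
    is_fcover L f -> exists I : {set H}, is_coloring G I.

(* Main.v *)
Require Import Defs.
From mathcomp Require Import all_boot.
From mathcomp Require Import zify.
From Stdlib Require Import Classical_Prop.

(** Fixing the colour [a] of the apex removes at most one colour from every
other list, so it remains to colour [G] from lists of size at least 2.
Vertices of degree 1 can be peeled off and coloured last; since
[|V(G)| = |E(G)|], what remains is a single vertex, which is trivial, or a
connected 2-regular graph [S], i.e. a cycle.  Such an [S] can fail to be
colourable only if all its lists have size exactly 2 and the matching of every
edge is perfect.  If this happens for both colours [a1], [a2] of the apex, the
list of every [x] in [S] is [{p x, q x, r x}] with [a1 ~ p x] and [a2 ~ q x],
and every edge [x y] of [S] satisfies [r x ~ r y].  Then colouring one side of
the bipartition by [r] and the other one by [q] is a colouring compatible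
with [a1]. *)

Set Implicit Arguments.
Unset Strict Implicit.
Unset Printing Implicit Defensive.

(** * Degrees and cuts inside a vertex subset *)

Section Degrees.
Variable G : sgraph.
Implicit Types (S T : {set G}) (x y : G).

Definition nbrs S x : {set G} := [set y in S | adj x y].
Definition deg S x : nat := #|nbrs S x|.
(** Twice the number of edges of the subgraph induced by [S]. *)
Definition degsum S : nat := \sum_(x in S) deg S x.

(** Connectedness of the induced subgraph, phrased by cuts rather than paths so that deleting a leaf
    only requires adjusting the cut. *)
Definition cut_connected S : Prop :=
  forall T, T \subset S -> T != set0 -> T != S ->
    exists x y, [/\ x \in T, y \in S :\: T & adj x y].

Lemma nbrsD1 S x : nbrs (S :\ x) x = nbrs S x.
Proof.
apply/setP=> y; rewrite !inE.
by case: eqP => [->|] //=; rewrite adj_irrefl andbF.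
Qed.

Lemma deg_leS S T x : T \subset S -> deg T x <= deg S x.
Proof.
move=> /subsetP sTS; apply: subset_leq_card; apply/subsetP=> y.
by rewrite !inE => /andP[/sTS -> ->].
Qed.

Lemma degD1 S x y : x \in S -> deg S y = deg (S :\ x) y + adj x y.
Proof.
move=> xS; rewrite /deg (cardsD1 x (nbrs S y)) !inE xS adj_sym addnC /=.
by congr (_ + _); apply: eq_card => z; rewrite !inE andbA.
Qed.

Lemma degsumD1 S x : x \in S -> degsum S = degsum (S :\ x) + 2 * deg S x.
Proof.
move=> xS; rewrite /degsum (big_setD1 x xS) /=.
under eq_bigr => y _ do rewrite (degD1 y xS).
rewrite big_split /= -big_mkcondr /= sum1_card.
have -> : #|[pred y | (y \in S :\ x) && adj x y]| = deg S x.
  by rewrite /deg -nbrsD1; apply: eq_card => y; rewrite !inE.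
lia.
Qed.

Lemma degsum_even S : ~~ odd (degsum S).
Proof.
have [n] := ubnP #|S|; elim: n S => // n IHn S.
have [->|[x xS]] := set_0Vmem S; first by rewrite /degsum big_set0.
rewrite (cardsD1 x) xS ltnS => /IHn.
by rewrite (degsumD1 xS) oddD mul2n odd_double addbF.
Qed.

(** Double counting of incidences: [y] maps to [[set x; y]] injectively from the neighbours of [x]
    to the edges through [x], and an edge has at most two ends. *)
Lemma degsumT : degsum [set: G] <= 2 * #|edges G|.
Proof.
apply: (@leq_trans (\sum_(x : G) \sum_(e in edges G) (x \in e))).
  rewrite /degsum (eq_bigl _ _ (@in_setT G)); apply: leq_sum => x _.
  rewrite -big_mkcondr /= sum1_card.
  rewrite /deg -(@card_in_imset _ _ (fun y => [set x; y])).
    apply: subset_leq_card; apply/subsetP=> e /imsetP[y].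
    rewrite !inE /= => xy ->; rewrite unfold_in !inE eqxx andbT.
    by apply/imset2P; exists x y; rewrite ?inE.
  move=> y z; rewrite !inE /= => xy _ /setP/(_ y).
  rewrite !inE eqxx orbT => /esym/orP[]/eqP // yx.
  by rewrite yx adj_irrefl in xy.
rewrite exchange_big /= mulnC -sum_nat_const; apply: leq_sum => e.
case/imset2P=> x y _ _ ->; rewrite -big_mkcond sum1_card.
by rewrite cards2; case: (_ != _).
Qed.

Lemma cut_connectedT : connected G -> cut_connected [set: G].
Proof.
move=> [_ Gc] T _ /set0Pn[x xT]; rewrite eqEsubset subsetT /= => /subsetPn.
case=> y _ yT.
case: (pickP [pred e : G * G | [&& e.1 \in T, e.2 \notin T & adj e.1 e.2]]).
  by move=> [a b] /= /and3P[aT bT ab]; exists a, b; rewrite !inE aT bT ab.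
move=> noedge; have Tcl : closed (@adj G) T.
  apply: intro_closed => [|a b]; first exact/sym_connect_sym/adj_sym.
  move=> ab aT; apply/negPn/negP => bT.
  by have := noedge (a, b); rewrite /= aT bT ab.
by have := closed_connect Tcl (Gc x y); rewrite xT (negbTE yT).
Qed.

(** Let [w] be the only neighbour of [x]. If [w] is in [T], the cut [x |: T] of [S] is crossed by an
    edge avoiding [x]; otherwise no edge from [T] can end in [x]. *)
Lemma cut_connectedD1 S x :
  x \in S -> deg S x = 1 -> cut_connected S -> cut_connected (S :\ x).
Proof.
move=> xS /eqP/cards1P[w xw] Sc T sT T0 TS.
have nbrx y : y \in S -> adj x y -> y = w.
  by move=> yS xy; apply/set1P; rewrite -xw inE yS.
have xT : x \notin T by apply/negP=> /(subsetP sT); rewrite !inE eqxx.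
have sTS : T \subset S := subset_trans sT (subD1set S x).
have [wT|wT] := boolP (w \in T).
  have [||| a [b []]] := Sc (x |: T).
  - by rewrite subUset sub1set xS.
  - by apply/set0Pn; exists x; rewrite !inE eqxx.
  - by apply: contra TS => /eqP <-; rewrite setU1K.
  rewrite !inE negb_or => /orP[/eqP ->|aT] /andP[/andP[bx bT] bS] ab.
    by rewrite (nbrx b bS ab) wT in bT.
  by exists a, b; rewrite !inE bx bT bS.
have [|a [b []]] := Sc T sTS T0.
  by apply: contraNneq xT => ->.
move=> aT; rewrite !inE => /andP[bT bS] ab; exists a, b.
rewrite !inE bT bS aT ab andbT; split=> //=.
apply: contraNneq wT => bx; rewrite -(nbrx a) // ?(subsetP sTS) //.
by rewrite adj_sym -bx.
Qed.

Lemma cut_connected_deg_gt0 S x :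
  cut_connected S -> x \in S -> S != [set x] -> 0 < deg S x.
Proof.
move=> Sc xS Sx; have [|||a [b []]] := Sc [set x].
- by rewrite sub1set.
- by apply/set0Pn; exists x; rewrite inE.
- by rewrite eq_sym.
rewrite !inE => /eqP -> /andP[_ bS] xb.
by apply/card_gt0P; exists b; rewrite inE bS.
Qed.

(* For [S] a cycle, [T] is a disjoint union of paths one of which starts at
   [u]; parity provides the second end of that path. *)
Lemma two_regular_low_degree S T u v :
    cut_connected S -> (forall x, x \in S -> deg S x = 2) ->
    T \subset S :\ v -> u \in T -> v \in S -> adj u v -> T != [set u] ->
  exists2 y, y \in T :\ u & deg T y <= 1.
Proof.
move=> Sc S2 sT uT vS uv Tu.
have sTS : T \subset S := subset_trans sT (subD1set S v).
have vT : v \notin T by apply/negP=> /(subsetP sT); rewrite !inE eqxx.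
case: (pickP [pred y in T :\ u | deg T y <= 1]) => [y|degT].
  by case/andP=> yT dy; exists y.
have {}degT y : y \in T :\ u -> deg T y = 2.
  move=> yT; have := degT y; rewrite /= yT /= => dy.
  have yS : y \in S by apply: (subsetP sTS); case/setD1P: yT.
  have := deg_leS y sTS; rewrite (S2 y yS); lia.
(* Losing [v] leaves [u] with degree at most 1, and all other degrees in [T] are 2, so parity forces
   0. *)
have du0 : deg T u = 0.
  have du1 : deg T u <= 1.
    have := degD1 u vS; rewrite adj_sym uv (S2 _ (subsetP sTS _ uT)).
    have := deg_leS u sT; lia.
  have := degsum_even T; rewrite /degsum (big_setD1 u uT) /=.
  rewrite (eq_bigr (fun=> 2)) // sum_nat_const oddD oddM andbF addbF.
  by case: (deg T u) du1 => [|[]].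
(* No edge can leave [T :\ u]: its vertices have both their [S]-neighbours in [T], and [u] is
   isolated in [T]. *)
have [|||a [b [aT]]] := Sc (T :\ u).
- exact: subset_trans (subD1set T u) sTS.
- by rewrite setD_eq0 subset1 negb_or Tu; apply/set0Pn; exists u.
- by apply: contraNneq vT => TS; move: vS; rewrite -TS => /setD1P[].
rewrite !inE negb_and negbK => /andP[bTu bS] ab.
have aS : a \in S by apply: (subsetP sTS); case/setD1P: aT.
have nE : nbrs T a = nbrs S a.
  apply/eqP; rewrite eqEcard -/(deg S a) -/(deg T a) S2 // degT // andbT.
  by apply/subsetP=> z; rewrite !inE => /andP[/(subsetP sTS) -> ->].
have bT : b \in T.
  have : b \in nbrs S a by rewrite inE bS.
  by rewrite -nE inE => /andP[].
move: bTu; rewrite bT orbF => /eqP bu.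
suff : 0 < deg T u by rewrite du0.
by apply/card_gt0P; exists a; rewrite inE -bu adj_sym ab; case/setD1P: aT => _ ->.
Qed.

End Degrees.

(** * Greedy extension of partial colourings, and uncolourable cycles *)

Section PartialColorings.
Variables (G H : sgraph) (M : G -> {set H}).
Implicit Types (S T : {set G}) (g : G -> H).

(** The matching condition alone; unlike being a cover, it survives the removal of colours from
    lists. *)
Definition matched_lists : Prop :=
  forall u v h k1 k2, adj u v -> h \in M u -> k1 \in M v -> k2 \in M v ->
    adj h k1 -> adj h k2 -> k1 = k2.

Definition partial_coloring S g : Prop :=
  (forall x, x \in S -> g x \in M x) /\
  (forall x y, x \in S -> y \in S -> adj x y -> ~~ adj (g x) (g y)).

Hypothesis Mmatch : matched_lists.

Definition blocked g (y v : G) : {set H} := [set c in M v | adj (g y) c].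

Lemma card_blocked g y v : adj y v -> g y \in M y -> #|blocked g y v| <= 1.
Proof.
move=> yv gy; rewrite leqNgt; apply/negP => /card_gt1P[k1 [k2 []]].
rewrite !inE => /andP[k1v h1] /andP[k2v h2] /eqP[].
exact: Mmatch yv gy k1v k2v h1 h2.
Qed.

(** Union bound on the blocked colours. Counting these rather than neighbours lets a neighbour that
    blocks nothing be exploited. *)
Lemma extend_coloring T g v :
    v \notin T -> partial_coloring T g ->
    \sum_(y in nbrs T v) #|blocked g y v| < #|M v| ->
  exists g', partial_coloring (v |: T) g' /\ {in T, g' =1 g}.
Proof.
move=> vT [gM gadj] lt_blocked.
have [c cM cfree] : exists2 c, c \in M v & forall y, y \in T -> adj v y ->
    ~~ adj (g y) c.
  have : ~~ (M v \subset \bigcup_(y in nbrs T v) blocked g y v).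
    apply: contraTN lt_blocked => /subset_leq_card leM; rewrite -leqNgt.
    apply: leq_trans leM _.
    elim/big_rec2: _ => [|y A n _ IH]; first by rewrite cards0.
    by apply: leq_trans (leq_card_setU _ _) _; rewrite leq_add2l.
  case/subsetPn=> c cM /bigcupP cfree; exists c => // y yT vy.
  by apply/negP=> gyc; apply: cfree; exists y; rewrite inE ?yT ?cM.
pose g' x := if x == v then c else g x.
have g'T : {in T, g' =1 g}.
  by move=> x xT; rewrite /g'; case: eqP vT => // <-; rewrite xT.
have g'v : g' v = c by rewrite /g' eqxx.
exists g'; split=> //; split.
  by move=> x /setU1P[->|xT]; rewrite ?g'v // g'T // gM.
move=> x y /setU1P[->|xT] /setU1P[->|yT]; rewrite ?g'v ?g'T //.
- by rewrite adj_irrefl.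
- by rewrite [X in ~~ X]adj_sym; apply: cfree.
- by rewrite adj_sym; apply: cfree.
- exact: gadj.
Qed.

Lemma extend_coloring_deg T g v :
    v \notin T -> partial_coloring T g -> deg T v < #|M v| ->
  exists g', partial_coloring (v |: T) g' /\ {in T, g' =1 g}.
Proof.
move=> vT gT dv; apply: extend_coloring => //.
apply: leq_ltn_trans dv; rewrite /deg -sum1_card; apply: leq_sum => y.
rewrite inE => /andP[yT vy]; apply: card_blocked; first by rewrite adj_sym.
by case: gT => gM _; apply: gM.
Qed.

Hypothesis M2 : forall x, 2 <= #|M x|.

Lemma color_cycle_minus_vertex S u v c :
    cut_connected S -> (forall x, x \in S -> deg S x = 2) ->
    u \in S -> v \in S -> adj u v -> c \in M u ->
  exists g, partial_coloring (S :\ v) g /\ g u = c.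
Proof.
move=> Sc S2 uS vS uv cM.
suff ext T : T \subset S :\ v -> u \in T ->
    exists g, partial_coloring T g /\ g u = c.
  apply: ext => //; rewrite !inE uS andbT.
  by apply: contraTneq uv => ->; rewrite adj_irrefl.
have [n] := ubnP #|T|; elim: n T => // n IHn T ltn sT uT.
have [->|Tu] := eqVneq T [set u].
  exists (fun=> c); split=> //; split=> [x /set1P -> //|x y].
  by move=> /set1P -> /set1P ->; rewrite adj_irrefl.
have [y /setD1P[yu yT] dy] := two_regular_low_degree Sc S2 sT uT vS uv Tu.
have uTy : u \in T :\ y by rewrite !inE eq_sym yu.
have [||g [gT gu]] := IHn (T :\ y) _ _ uTy.
- by move: ltn; rewrite (cardsD1 y) yT.
- exact: subset_trans (subD1set T y) sT.
have [||g' [g'T g'g]] := extend_coloring_deg (v := y) _ gT.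
- by rewrite !inE eqxx.
- apply: leq_ltn_trans (M2 y); rewrite (leq_trans _ dy) //.
  exact: deg_leS (subD1set T y).
by exists g'; rewrite -{1}(setD1K yT) g'g.
Qed.

(** Colour [S :\ v] with [c] at [u]. The two neighbours of [v] block at most one colour each, so a
    third colour in [M v], or a [c] blocking nothing there, would leave a colour for [v]. *)
Lemma uncolorable_cycle S :
    cut_connected S -> (forall x, x \in S -> deg S x = 2) ->
    ~ (exists g, partial_coloring S g) ->
  forall u v, u \in S -> v \in S -> adj u v ->
    #|M v| = 2 /\ forall c, c \in M u -> exists2 d, d \in M v & adj c d.
Proof.
move=> Sc S2 Sunc u v uS vS uv.
have ext c : c \in M u ->
    #|M v| <= 2 /\ exists2 d, d \in M v & adj c d.
  move=> cM.
  have [g [gS gu]] := color_cycle_minus_vertex Sc S2 uS vS uv cM.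
  have vSv : v \notin S :\ v by rewrite !inE eqxx.
  have dv : deg (S :\ v) v = 2 by rewrite /deg nbrsD1 -/(deg S v) S2.
  split.
    rewrite leqNgt; apply/negP => lt2; apply: Sunc.
    have [|g' [g'S _]] := extend_coloring_deg vSv gS; first by rewrite dv.
    by exists g'; rewrite -(setD1K vS).
  case: (pickP [pred d in M v | adj c d]) => [d /andP[dM cd]|free].
    by exists d.
  case: Sunc; have [|g' [g'S _]] := extend_coloring vSv gS; last first.
    by exists g'; rewrite -(setD1K vS).
  apply: leq_trans (M2 v); rewrite ltnS.
  have uN : u \in nbrs (S :\ v) v.
    by rewrite nbrsD1 inE uS adj_sym.
  rewrite (big_setD1 u uN) /= [X in X + _](_ : _ = 0); last first.
    apply/eqP; rewrite cards_eq0; apply/eqP/setP=> d.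
    by rewrite !inE gu; apply: free.
  apply: (@leq_trans (\sum_(y in nbrs (S :\ v) v :\ u) 1)).
    apply: leq_sum => y; rewrite !inE => /andP[_ /andP[yS vy]].
    apply: card_blocked; first by rewrite adj_sym.
    by case: gS => gM _; apply: gM; rewrite !inE.
  by move: dv; rewrite sum1_card /deg (cardsD1 u) uN; lia.
split; last by move=> c /ext[].
have [c cM] : exists c, c \in M u by apply/card_gt0P; apply: ltnW.
by apply/eqP; rewrite eqn_leq M2 andbT; case: (ext c cM).
Qed.

End PartialColorings.

(** * Passing between covers and partial colourings *)

Lemma cover_matched (G H : sgraph) (L : G -> {set H}) :
  is_cover L -> matched_lists L.
Proof.
move=> Lc u v h k1 k2 uv hu k1v k2v h1 h2.
have [_ /trivIsetP triv] := cover_matching Lc uv.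
have eq12 : [set h; k1] = [set h; k2].
  apply/eqP/negPn/negP => ne.
  have inM k : k \in L v -> adj h k ->
      [set h; k] \in edges_between (L u) (L v).
    by move=> kv hk; apply/imset2P; exists h k; rewrite ?inE ?kv.
  have /pred0P/(_ h) := triv _ _ (inM k1 k1v h1) (inM k2 k2v h2) ne.
  by rewrite /= !inE eqxx.
have : k1 \in [set h; k2] by rewrite -eq12 !inE eqxx orbT.
by rewrite !inE => /orP[]/eqP // k1h; rewrite k1h adj_irrefl in h1.
Qed.

(** Disjoint lists make [g] injective, and an edge between two chosen colours could only come from
    equal or adjacent vertices. *)
Lemma coloring_of_transversal (G H : sgraph) (L : G -> {set H}) (g : G -> H) :
  is_cover L -> partial_coloring L [set: G] g -> is_coloring G (g @: [set: G]).
Proof.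
move=> Lc [gL gadj]; split.
  move=> _ _ /imsetP[x _ ->] /imsetP[y _ ->]; apply/negP => gxy.
  have [|xy|xy] := @cover_edges _ _ _ Lc x y.
  - apply/set0Pn; exists [set g x; g y]; apply/imset2P.
    by exists (g x) (g y); rewrite ?inE ?gL.
  - by rewrite xy adj_irrefl in gxy.
  - by have := gadj x y; rewrite gxy !inE => /(_ isT isT xy).
rewrite card_imset ?cardsT // => x y gxy; apply/eqP/negPn/negP => xy.
have /pred0P/(_ (g x)) := cover_disjoint Lc xy.
by rewrite /= gL ?inE // gxy gL ?inE.
Qed.

(** * Colouring the cone *)

Section Cone.
Variables (G H : sgraph) (L : cone G -> {set H}).
Hypotheses (Lc : is_cover L) (L3 : forall x : G, #|L (Some x)| = 3).
Variable A : {set G}.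
Hypothesis bip : forall x y : G, adj x y -> (x \in A) != (y \in A).

(** The colours of [x] still available once the apex has colour [a]. *)
Definition residual (a : H) (x : G) : {set H} :=
  [set c in L (Some x) | ~~ adj a c].

Lemma residual_matched a : matched_lists (residual a).
Proof.
move=> u v h k1 k2 uv; rewrite !inE => /andP[hu _] /andP[k1v _] /andP[k2v _].
exact: (cover_matched Lc (u := Some u) (v := Some v)).
Qed.

(** The matching between the lists of the apex and of [x] lets [a] remove at most one of the three
    colours. *)
Lemma card_residual a (x : G) :
  a \in L None -> 2 <= #|residual a x| /\
    (#|residual a x| = 2 -> exists2 p, p \in L (Some x) & adj a p).
Proof.
move=> aL; have [le1 tot] : #|[set c in L (Some x) | adj a c]| <= 1 /\
    #|[set c in L (Some x) | adj a c]| + #|residual a x| = 3.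
  split; last first.
    rewrite -(L3 x) -(cardsID [set c | adj a c] (L (Some x))).
    by congr (_ + _); apply: eq_card => c; rewrite !inE // andbC.
  rewrite leqNgt; apply/negP => /card_gt1P[k1 [k2 []]].
  rewrite !inE => /andP[k1v h1] /andP[k2v h2] /eqP[].
  exact: (cover_matched Lc (u := None) (v := Some x)) aL k1v k2v h1 h2.
split; first lia.
move=> r2; have /card_gt0P[p] : 0 < #|[set c in L (Some x) | adj a c]| by lia.
by rewrite inE => /andP[pL ap]; exists p.
Qed.

Variables a1 a2 : H.
Hypotheses (a1L : a1 \in L None) (a2L : a2 \in L None) (a12 : a1 != a2).

Lemma cone_cycle_colorable (S : {set G}) :
    cut_connected S -> (forall x, x \in S -> deg S x = 2) ->
    ~ (exists g, partial_coloring (residual a1) S g) ->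
    ~ (exists g, partial_coloring (residual a2) S g) -> False.
Proof.
move=> Sc S2 unc1 unc2.
have cyc1 := uncolorable_cycle (@residual_matched a1)
  (fun x => (card_residual x a1L).1) Sc S2 unc1.
have cyc2 := uncolorable_cycle (@residual_matched a2)
  (fun x => (card_residual x a2L).1) Sc S2 unc2.
have nodouble x c : c \in L (Some x) -> adj a1 c -> adj a2 c -> False.
  move=> cL; rewrite !(adj_sym _ c) => ca1 ca2; case/eqP: a12.
  exact: (cover_matched Lc (u := Some x) (v := None)) cL a1L a2L ca1 ca2.
(* The pair is [(q, r)]; outside [S] the value [(a1, a1)] is a dummy that makes the choice total. *)
have pqr x : exists qr : H * H, x \in S ->
    [/\ qr.1 \in residual a1 x, qr.2 \in residual a1 x,
        qr.2 != qr.1 &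
        residual a1 x :&: residual a2 x = [set qr.2]].
  have [xS|] := boolP (x \in S); last by exists (a1, a1).
  have [y] : exists y, y \in nbrs S x.
    by apply/card_gt0P; rewrite -/(deg S x) S2.
  rewrite inE adj_sym => /andP[yS yx].
  have [c1 _] := cyc1 y x yS xS yx.
  have [c2 _] := cyc2 y x yS xS yx.
  have [p pL a1p] := (card_residual x a1L).2 c1.
  have [q qL a2q] := (card_residual x a2L).2 c2.
  have qr1 : q \in residual a1 x.
    by rewrite inE qL; apply/negP=> a1q; apply: nodouble qL a1q a2q.
  have int2 : residual a1 x :&: residual a2 x = residual a1 x :\ q.
    apply/eqP; rewrite eqEcard; apply/andP; split.
      apply/subsetP=> c; rewrite !inE => /andP[/andP[-> ->] /andP[_ ca2]].
      by rewrite !andbT; apply: contraNneq ca2 => ->.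
    have -> : #|residual a1 x :\ q| = 1.
      by move: c1; rewrite (cardsD1 q) qr1 => -[].
    apply/card_gt0P.
    (* A colour other than [p] and [q] is adjacent to neither [a1] nor [a2], whose matching partners
       in this list are [p] and [q]. *)
    have /card_gt0P[r] : 0 < #|L (Some x) :\ p :\ q|.
      have := L3 x; rewrite (cardsD1 p) pL (cardsD1 q (L _ :\ p)).
      by case: (q \in _); lia.
    rewrite !inE => /and3P[rq rp rL]; exists r.
    rewrite !inE rL /=; apply/andP; split; apply/negP => ar.
      case/eqP: rp.
      exact: (cover_matched Lc (u := None) (v := Some x)) a1L rL pL ar a1p.
    case/eqP: rq.
    exact: (cover_matched Lc (u := None) (v := Some x)) a2L rL qL ar a2q.
  have /cards1P[r rE] : #|residual a1 x :\ q| == 1.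
    by move: c1; rewrite (cardsD1 q) qr1 => -[/eqP].
  exists (q, r) => _ /=; have : r \in residual a1 x :\ q by rewrite rE inE.
  by rewrite in_setD1 => /andP[rq r1]; split=> //; rewrite int2.
have [qr qrP] := fin_all_exists pqr.
(* The partner of [r x] found in each of the two residual lists of [y] is the same by matching, so
   it lies in their intersection, which is the singleton of [r y]. *)
have rr x y : x \in S -> y \in S -> adj x y -> adj (qr x).2 (qr y).2.
  move=> xS yS xy; have [_ _ _ xI] := qrP x xS.
  have /setIP[r1 r2] : (qr x).2 \in residual a1 x :&: residual a2 x.
    by rewrite xI inE.
  have [_ /(_ _ r1)[d1 d1y rd1]] := cyc1 x y xS yS xy.
  have [_ /(_ _ r2)[d2 d2y rd2]] := cyc2 x y xS yS xy.
  have d12 : d1 = d2.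
    move: r1 d1y d2y; rewrite !inE => /andP[rL _] /andP[d1L _] /andP[d2L _].
    exact: (cover_matched Lc (u := Some x) (v := Some y)) rL d1L d2L rd1 rd2.
  have [_ _ _ yI] := qrP y yS.
  have : d1 \in residual a1 y :&: residual a2 y by rewrite inE d1y d12.
  by rewrite yI inE => /eqP <-.
(* The only partner of [r x] at [y] is [r y], which differs from [q y]. *)
have rq x y : x \in S -> y \in S -> adj x y -> ~~ adj (qr x).2 (qr y).1.
  move=> xS yS xy; apply/negP => rxqy.
  have [_ rx _ _] := qrP x xS; have [qy ry /eqP rqy _] := qrP y yS.
  exact: rqy (residual_matched xy rx ry qy (rr _ _ xS yS xy) rxqy).
apply: unc1; exists (fun x => if x \in A then (qr x).2 else (qr x).1).
split=> [x xS|x y xS yS xy].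
  by have [qx rx _ _] := qrP x xS; case: ifP.
have := bip xy; case: (x \in A); case: (y \in A) => // _; first exact: rq.
by rewrite adj_sym; apply: rq; rewrite // adj_sym.
Qed.

(** Deleting a leaf lowers both sides of the degree bound by 2, so the bound is inductive. The apex
    colour [a] is dictated by what remains after peeling; any such [a] leaves the peeled vertices
    enough colours. *)
Lemma cone_subset_colorable (S : {set G}) :
    S != set0 -> cut_connected S -> degsum S <= 2 * #|S| ->
  exists2 a, a \in L None & exists g, partial_coloring (residual a) S g.
Proof.
have [n] := ubnP #|S|; elim: n S => // n IHn S ltn S0 Sc dS.
have [[x xS dx]|S2] : (exists2 x, x \in S & deg S x <= 1) \/
    (forall x, x \in S -> 2 <= deg S x).
  case: (pickP [pred x in S | deg S x <= 1]) => [x /andP[xS dx]|S2].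
    by left; exists x.
  by right=> x xS; have := S2 x; rewrite /= xS /= leqNgt => /negbFE.
- have xSx : x \notin S :\ x by rewrite !inE eqxx.
  have ext a g : a \in L None -> partial_coloring (residual a) (S :\ x) g ->
      exists g, partial_coloring (residual a) S g.
    move=> aL gS; have [|g' [g'S _]] :=
      extend_coloring_deg (@residual_matched a) xSx gS.
      apply: leq_ltn_trans (card_residual x aL).1.
      exact: leq_trans (deg_leS x (subD1set S x)) dx.
    by exists g'; rewrite -(setD1K xS).
  have [Sx|Sx] := eqVneq S [set x].
    exists a1 => //; apply: (ext a1 (fun=> a1)) => //.
    by rewrite Sx setDv; split=> [y|y z]; rewrite inE.
  have {}dx : deg S x = 1.
    by apply/eqP; rewrite eqn_leq dx cut_connected_deg_gt0.
  have cS : #|S| = #|S :\ x|.+1 by rewrite (cardsD1 x) xS.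
  have [||||a aL [g gS]] := IHn (S :\ x).
  + by rewrite -ltnS -cS.
  + by rewrite setD_eq0 subset1 negb_or Sx.
  + exact: cut_connectedD1.
  + by move: dS; rewrite (degsumD1 xS) dx cS; lia.
  by exists a => //; apply: ext gS.
(* All degrees are at least 2 and their average is at most 2. *)
- have {}S2 x : x \in S -> deg S x = 2.
    move=> xS; apply/eqP; rewrite eqn_leq S2 // andbT.
    move: dS; rewrite /degsum mulnC -sum_nat_const !(big_setD1 x xS) /=.
    have : \sum_(y in S :\ x) 2 <= \sum_(y in S :\ x) deg S y.
      by apply: leq_sum => y /setD1P[_]; apply: S2.
    lia.
  have [c1|unc1] := classic (exists g, partial_coloring (residual a1) S g).
    by exists a1.
  have [c2|unc2] := classic (exists g, partial_coloring (residual a2) S g).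
    by exists a2.
  by case: (cone_cycle_colorable Sc S2 unc1 unc2).
Qed.

End Cone.

Theorem theorem1p4 (G : sgraph) (f : cone G -> nat)
  (G_connected : connected G) (G_bipartite : bipartite G)
  (G_card : #|G| = #|edges G|)
  (f_apex : f (apex G) = 2)
  (f_other : forall v : cone G, v <> apex G -> f v = 3) :
  DP_colorable f.
Proof.
move=> H L [Lc Lf]; have [A bip] := G_bipartite.
have L3 (x : G) : #|L (Some x)| = 3 by rewrite Lf f_other.
have /card_gt1P[a1 [a2 [a1L a2L a12]]] : 1 < #|L None|.
  by rewrite Lf -/(apex G) f_apex.
have [|||a aL [g [gL gadj]]] :=
  cone_subset_colorable Lc L3 bip a1L a2L a12 (S := [set: G]).
- by rewrite -card_gt0 cardsT; case: G_connected.
- exact: cut_connectedT.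
- by rewrite cardsT G_card degsumT.
have {}gL x : g x \in L (Some x) /\ ~~ adj a (g x).
  by have := gL x; rewrite !inE => /(_ isT)/andP.
exists ((fun x : cone G => if x is Some y then g y else a) @: [set: cone G]).
apply: (coloring_of_transversal Lc); split=> [[x|] _ //|].
  by case: (gL x).
case=> [x|] [y|] _ _ //= xy.
- by apply: gadj.
- by rewrite adj_sym; case: (gL x).
- by case: (gL y).
Qed.
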